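(* Let $S$ be a commutative monoid (under composition) of positive linear maps $V\to V$ in an ordered vector space $V$ and let $v\in V^+$. Suppose that on the linear span $\mathrm{Span}(Sv)$ of the orbit $Sv=\{Tv:T\in S\}$ there is a positive linear functional that is bounded on $Sv$ and non-zero on $v$. Then there is a positive linear functional $J$ on the orbit ideal $V_{Sv}$ and a monoid homomorphism $t\colon S\to[0,1]$ such that $$J(Tu)=t(T)\,J(u)\quad\text{for all } T\in S \text{ and all } u\in V_{Sv},\qquad\text{and}\qquad J(v)=1.$$
   Context: Vector spaces are over $\mathbf{R}$. An ordered vector space is a real vector space $V$ with a partial order compatible with the linear structure (translation-invariant and invariant under multiplication by non-negative scalars); $V^+=\{v\in V: v\geq 0\}$. No topology on $V$ is assumed. A linear map $T\colon V\to V$ is positive if $T(V^+)\subseteq V^+$; a linear functional on a linear subspace of $V$ (with the induced order) is positive if it takes non-negative values on the elements $\geq 0$ of that subspace. A monoid of linear maps $V\to V$ is a set of such maps closed under composition and containing the identity. The interval $[0,1]$ is regarded as a monoid under multiplication. The orbit ideal $V_{Sv}$ is the smallest vector subspace of $V$ that contains the orbit $Sv$ and is closed under order intervals (if $x\leq y\leq z$ with $x,z$ in the subspace, then $y$ is in the subspace). Equivalently, it consists of the $u\in V$ for which there are $a_1,\dots,a_q\in Sv$ with $\pm u\leq a_1+\cdots+a_q$; every $T\in S$ maps it to itself. *)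

(* Defs.v *)
From HB Require Import structures.
From mathcomp Require Import all_boot all_order all_algebra.
From mathcomp Require Import boolp classical_sets reals.

Set Implicit Arguments.
Unset Strict Implicit.
Unset Printing Implicit Defensive.

Import Order.TTheory GRing.Theory Num.Theory.
Local Open Scope classical_set_scope.
Local Open Scope ring_scope.

HB.mixin Record isOrderedLmodule (R : numDomainType) V
    of Num.POrderedZmodule V & GRing.Lmodule R V := {
  olmod_leD2l : forall u x y : V, x <= y -> u + x <= u + y ;
  olmod_leZ2l : forall (a : R) (x y : V), 0 <= a -> x <= y -> a *: x <= a *: y
}.

#[short(type="orderedLmodType")]
HB.structure Definition OrderedLmodule (R : numDomainType) :=
  { V of isOrderedLmodule R V & Num.POrderedZmodule V & GRing.Lmodule R V }.

Section OrderedVectorSpace.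
Context {R : realType} {V : orderedLmodType R}.
Implicit Types (W A : set V) (S : set {linear V -> V}) (v : V).

Definition positive_map (T : {linear V -> V}) := forall x, 0 <= x -> 0 <= T x.

Definition map_monoid S :=
  S idfun /\ (forall T U, S T -> S U -> S (T \o U)).

Definition commuting_maps S :=
  forall T U, S T -> S U -> T \o U =1 U \o T.

Definition map_orbit S v : set V := [set T v | T in S].

Definition is_subspace W := GRing.submod_closed [in W].

Definition order_convex W :=
  forall x y z : V, W x -> W z -> x <= y <= z -> W y.

Definition linear_span A : set V := smallest is_subspace A.

Definition orbit_ideal S v : set V :=
  smallest (fun W => is_subspace W /\ order_convex W) (map_orbit S v).

(* Only the values on [W] matter: a functional on [W] is represented by an
   arbitrary extension of it to a function on all of [V]. *)
Definition linear_functional_on W (f : V -> R) :=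
  forall (a : R) (x y : V), W x -> W y -> f (a *: x + y) = a * f x + f y.

Definition positive_functional_on W (f : V -> R) :=
  linear_functional_on W f /\ (forall x, W x -> 0 <= x -> 0 <= f x).

Definition bounded_on A (f : V -> R) :=
  exists M : R, forall x, A x -> `|f x| <= M.

(* As above, only the values of [t] on [S] matter. *)
Definition unit_interval_morphism S (t : {linear V -> V} -> R) :=
  [/\ forall T, S T -> 0 <= t T <= 1,
      t idfun = 1
    & forall T U, S T -> S U -> t (T \o U) = t T * t U].

End OrderedVectorSpace.

(* Main.v *)
Require Import Defs.
From mathcomp Require Import all_boot all_order all_algebra.
From mathcomp Require Import boolp classical_sets reals.
From mathcomp Require Import topology normedtype sequences function_spaces.
From mathcomp Require Import lra ring.

Set Implicit Arguments.
Unset Strict Implicit.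
Unset Printing Implicit Defensive.

Import Order.TTheory GRing.Theory Num.Theory.
Import numFieldNormedType.Exports.
Local Open Scope classical_set_scope.
Local Open Scope ring_scope.

(** A joint eigenfunctional for the adjoint action of [S] is a limit of
    approximate ones, in the spirit of a Krein-Rutman theorem for commuting
    families.  Let [W] be the span of the orbit and [E] the set of vectors lying
    between [- a] and [a] for some [a] in [W]; [E] contains the orbit ideal and
    is mapped into itself by [S].  Since [W] majorizes [E], the given functional
    extends to a positive functional on [E]
    ([positive_functional_extension], a Kantorovich extension).

    Size a positive functional [h] on [E] by [p h], the supremum of [h (U v)] over
    [U] in [S].  Composing with a member of [S] does not increase [p], and
    [`|h u| <= c u * p h] where [c u] depends only on [u] ([orbit_gauge]).

    The heart of the proof treats a single [T] ([approximate_eigenfunctional]).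
    Start from [f] with [f v > 0], put [g n = f o T^n] and [b n = p (g n)]; the
    exponential rate of the bounded sequence [b] lies between two close numbers
    [s1 < s2].  Take a finite sum of the [g n] with weights proportional to
    [s1 ^- n] up to some [m] and to [s2 ^- n] from there on.  Composition with
    [T] multiplies it almost by the scalar [s1]: the two boundary terms are
    negligible for [p], because the weighted terms are small at both ends of the
    sum compared with the one at [m] ([geometric_growth]).  The
    value of this sum at [v] may be small compared with its size [p]; but since
    [S] is commutative, composing the sum with some [U] in [S] that almost attains
    the supremum preserves all the estimates and makes the value at [v] at least
    half of [p].

    The normalized functionals so obtained live in a box of functions [V -> R]
    that is compact for pointwise convergence, so exact eigenfunctionals of [T]
    exist as cluster points.  Only positive combinations and compositions
    with members of [S] were used, so eigenvector relations that [f] already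
    satisfies for other members of [S] survive
    ([eigenstates_add_generator]).  Induction gives a common eigenfunctional for
    every finite part of [S], and compactness once more gives one for all of [S]
    ([common_eigenstate]).  Its eigenvalues form the
    character; they are at most 1 because [p] is finite
    ([eigenstate_character]). *)

(** * Ordered vector spaces and subspaces *)

Section OrderedModule.
Context {R : realType} {V : orderedLmodType R}.
Implicit Types (x y z : V) (W E : set V).

Lemma olmod_subr_ge0 x y : (0 <= y - x) = (x <= y).
Proof.
apply/idP/idP => h.
  by have := olmod_leD2l x _ _ h; rewrite addr0 addrC subrK.
by have := olmod_leD2l (- x) _ _ h; rewrite addNr addrC.
Qed.

Lemma olmod_addr_ge0 x y : 0 <= x -> 0 <= y -> 0 <= x + y.
Proof. by move=> x0 /(olmod_leD2l x _ _); rewrite addr0; exact: le_trans. Qed.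

Lemma olmod_scaler_ge0 (a : R) x : 0 <= a -> 0 <= x -> 0 <= a *: x.
Proof. by move=> a0 /(olmod_leZ2l _ _ _ a0); rewrite scaler0. Qed.

Lemma subspace_closed W : is_subspace W <->
  W 0 /\ (forall (a : R) x y, W x -> W y -> W (a *: x + y)).
Proof.
split=> [[]|[W0 WD]].
  rewrite inE => W0 WD; split=> // a x y Wx Wy.
  by apply: set_mem; apply: WD; apply: mem_set.
split=> [|a x y]; first by rewrite inE.
by rewrite !inE; exact: WD.
Qed.

Lemma subspace0 W : is_subspace W -> W 0.
Proof. by case/subspace_closed. Qed.

Lemma subspaceZD W (a : R) x y : is_subspace W -> W x -> W y -> W (a *: x + y).
Proof. by case/subspace_closed => _; apply. Qed.

Lemma subspaceD W x y : is_subspace W -> W x -> W y -> W (x + y).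
Proof. by move=> sW Wx Wy; rewrite -[x]scale1r; exact: subspaceZD. Qed.

Lemma subspaceZ W (a : R) x : is_subspace W -> W x -> W (a *: x).
Proof.
by move=> sW Wx; rewrite -[_ *: _]addr0; apply: subspaceZD => //; exact: subspace0.
Qed.

Lemma subspaceN W x : is_subspace W -> W x -> W (- x).
Proof. by move=> sW Wx; rewrite -scaleN1r; exact: subspaceZ. Qed.

Lemma linear_span_subspace W : is_subspace (linear_span W).
Proof.
apply/subspace_closed; split=> [A [/subspace0]//|a x y Wx Wy A AW].
by apply: subspaceZD; [case: AW|exact: Wx|exact: Wy].
Qed.

Section Functional.
Context (E : set V) (f : V -> R).
Context (sE : is_subspace E) (lf : linear_functional_on E f).

Lemma functional0 : f 0 = 0.
Proof.
have E0 := subspace0 sE.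
by have := lf 1 E0 E0; rewrite scaler0 addr0 mul1r => fE; lra.
Qed.

Lemma functionalD x y : E x -> E y -> f (x + y) = f x + f y.
Proof. by move=> Ex Ey; have := lf 1 Ex Ey; rewrite scale1r mul1r. Qed.

Lemma functionalB x y : E x -> E y -> f (x - y) = f x - f y.
Proof. by move=> Ex Ey; rewrite addrC -scaleN1r lf// mulN1r addrC. Qed.

End Functional.

(** * Kantorovich extension of positive functionals *)

(** A subspace of [V * R] meeting the positive vectors only at non-negative values
    is automatically the graph of a function, so that Zorn's lemma can be
    run on such subspaces ordered by inclusion. *)
Definition positive_graph E (G : set (V * R)) :=
  [/\ forall (a : R) p q, G p -> G q -> G (a *: p.1 + q.1, a * p.2 + q.2),
      forall p, G p -> E p.1
    & forall p, G p -> 0 <= p.1 -> 0 <= p.2].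

Section Graph.
Context (E : set V) (G : set (V * R)).
Context (gG : positive_graph E G).

Lemma positive_graph_le p q : G p -> G q -> p.1 <= q.1 -> p.2 <= q.2.
Proof.
case: gG => GD _ Gpos Gp Gq le_pq.
have /Gpos := GD (- 1) _ _ Gp Gq; rewrite /= scaleN1r addrC olmod_subr_ge0.
by move=> /(_ le_pq); rewrite mulN1r addrC subr_ge0.
Qed.

Lemma positive_graph_inj p q : G p -> G q -> p.1 = q.1 -> p.2 = q.2.
Proof.
move=> Gp Gq epq; apply/eqP; rewrite eq_le.
by rewrite !positive_graph_le//= epq.
Qed.

Lemma positive_graphZ (a : R) p : G p -> G (a *: p.1, a * p.2).
Proof.
case: gG => GD _ _ Gp.
have := GD (a - 1) _ _ Gp Gp.
by rewrite scalerBl scale1r subrK mulrBl mul1r subrK.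
Qed.

(** The value at the new vector [u] is the supremum of the values at the
    elements of the domain below [u]; it is at most every value at an element
    of the domain above [u], which is what positivity requires on both sides. *)
Lemma positive_graph_extend u : is_subspace E -> E u ->
    (exists2 p, G p & u <= p.1) -> (exists2 p, G p & p.1 <= u) ->
  exists al : R, positive_graph E
    [set p | exists2 q, G q & exists s : R, p = (q.1 + s *: u, q.2 + s * al)].
Proof.
move=> sE Eu [pu Gpu le_upu] [pl Gpl le_plu]; have [GD GE Gpos] := gG.
pose A := [set a : R | exists2 q, G q & q.1 <= u /\ q.2 = a].
have ubA p : G p -> u <= p.1 -> ubound A p.2.
  move=> Gp le_up _ [q Gq [le_qu <-]].
  by apply: positive_graph_le => //; exact: le_trans le_up.
have supA : has_sup A.
  by split; [exists pl.2, pl|exists pu.2; exact: ubA].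
exists (sup A); split=> [a _ _ [p Gp [s ->]] [q Gq [r ->]]|_ [q Gq [s ->]]|].
- exists (a *: p.1 + q.1, a * p.2 + q.2); first exact: GD.
  exists (a * s + r) => /=; congr pair.
    by rewrite scalerDr scalerA addrACA -scalerDl.
  by lra.
- by apply: subspaceD => //=; [exact: GE|exact: subspaceZ].
move=> _ [q Gq [s ->]] /=; have [s_lt0|s_gt0|->] := ltgtP s 0.
- have s'_gt0 : 0 < (- s)^-1 by rewrite invr_gt0 oppr_gt0.
  move/(olmod_scaler_ge0 (ltW s'_gt0)).
  have -> : q.1 + s *: u = q.1 - (- s) *: u by rewrite scaleNr opprK.
  rewrite scalerBr scalerA mulVf ?oppr_eq0 ?lt_eqF// scale1r olmod_subr_ge0 => le_u.
  have /(ge_sup supA.1) := ubA _ (positive_graphZ (- s)^-1 Gq) le_u.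
  by rewrite /= mulrC ler_pdivlMr ?oppr_gt0// => ?; lra.
- have s'_gt0 : 0 < s^-1 by rewrite invr_gt0.
  move/(olmod_scaler_ge0 (ltW s'_gt0)).
  rewrite scalerDr scalerA mulVf ?gt_eqF// scale1r addrC -[s^-1 *: q.1]opprK.
  rewrite olmod_subr_ge0 -scaleNr => le_u.
  have : A (- s^-1 * q.2).
    by exists (- s^-1 *: q.1, - s^-1 * q.2) => //; exact: positive_graphZ.
  by move/(ub_le_sup supA.2); rewrite mulNr -mulrN mulrC ler_pdivrMr// => ?; lra.
- by rewrite scale0r mul0r !addr0; exact: Gpos.
Qed.

End Graph.

(** A maximal positive graph containing that of [phi] has domain [E]: the
    majorization hypothesis, applied to [u] and to [- u], encloses any missing [u]
    between elements of [W], and then [positive_graph_extend] applies. *)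
Lemma positive_functional_extension W E (phi : V -> R) :
    is_subspace W -> is_subspace E -> W `<=` E ->
    (forall u, E u -> exists2 w, W w & u <= w) ->
    positive_functional_on W phi ->
  exists2 f : V -> R, positive_functional_on E f & forall w, W w -> f w = phi w.
Proof.
move=> sW sE WE majW [phi_lin phi_pos].
pose G0 := [set p : V * R | W p.1 /\ p.2 = phi p.1].
have gG0 : positive_graph E G0.
  split=> [a [x b] [y c] [/= Wx ->] [/= Wy ->]|p [/WE]//|p [/phi_pos + ->]//].
  by split=> /=; [exact: subspaceZD|rewrite phi_lin].
(* Adjoining [G0] in the predicate lets the empty chain, whose union is empty,
   satisfy it. *)
have [|G [gG Gmax]] := @Zorn_bigcup _ (fun G => positive_graph E (G0 `|` G)).
  move=> F Fpos Ftot.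
  have pairF p q : (G0 `|` \bigcup_(X in F) X) p ->
      (G0 `|` \bigcup_(X in F) X) q -> exists H, [/\ positive_graph E (G0 `|` H),
        H `<=` \bigcup_(X in F) X, (G0 `|` H) p & (G0 `|` H) q].
    move=> [G0p|[X FX Xp]] [G0q|[Y FY Yq]].
    - by exists set0; split; rewrite ?setU0.
    - by exists Y; split; [exact: Fpos|exact: bigcup_sup|left|right].
    - by exists X; split; [exact: Fpos|exact: bigcup_sup|right|left].
    have [XY|YX] := Ftot _ _ FX FY.
    - by exists Y; split; [exact: Fpos|exact: bigcup_sup|right; exact: XY|right].
    - by exists X; split; [exact: Fpos|exact: bigcup_sup|right|right; exact: YX].
  split=> [a p q Hp Hq|p Hp|p Hp].
  - have [H [[HD _ _] sH G0p G0q]] := pairF _ _ Hp Hq.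
    by have := HD a _ _ G0p G0q; apply: setUS.
  - by have [H [[_ HE _] _ G0p _]] := pairF _ _ Hp Hp; exact: HE.
  - by have [H [[_ _ Hpos] _ G0p _]] := pairF _ _ Hp Hp; exact: Hpos.
set H := G0 `|` G in gG.
have domH u : E u -> exists a, H (u, a).
  move=> Eu.
  have [wu Wwu le_uwu] := majW u Eu.
  have [wl Wwl le_uwl] := majW (- u) (subspaceN sE Eu).
  have [| |al gH] := positive_graph_extend gG sE Eu.
  - by exists (wu, phi wu) => //; left.
  - exists (- wl, phi (- wl)) => /=.
      by left; split=> //=; exact: subspaceN.
    by rewrite -olmod_subr_ge0 opprK addrC -[u]opprK olmod_subr_ge0.
  set H' := [set p | _] in gH.
  have HH' : H `<=` H'.
    move=> [x b] Hxb; exists (x, b) => //; exists 0.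
    by rewrite scale0r mul0r !addr0.
  have H'u : H' (u, al).
    have [wGD _ _] := gG.
    exists (0, 0); last by exists 1; rewrite scale1r mul1r !add0r.
    left; split=> /=; first exact: subspace0.
    by rewrite (functional0 sW phi_lin).
  have [//|nHu] := pselect (exists a, H (u, a)).
  exfalso; apply: (Gmax H').
    split; first by move=> x Gx; apply: HH'; right.
    by move=> H'G; apply: nHu; exists al; right; exact: H'G.
  suff -> : G0 `|` H' = H' by [].
  by rewrite setUidPr// => x G0x; apply: HH'; left.
have [f fH] : {f : V -> R & forall u, E u -> H (u, f u)}.
  apply: (@choice _ _ (fun u a => E u -> H (u, a))) => u.
  have [Eu|nEu] := pselect (E u); last by exists 0.
  by have [a Ha] := domH u Eu; exists a.
have [HD HE Hpos] := gG.
exists f => [|w Ww].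
  split=> [a x y Ex Ey|x Ex x0]; last exact: (Hpos _ (fH x Ex)).
  apply: (positive_graph_inj gG (fH _ _) (HD a _ _ (fH x Ex) (fH y Ey))) => //.
  exact: subspaceZD.
by apply: (positive_graph_inj gG (fH _ (WE w Ww)) (q := (w, phi w))) => //; left.
Qed.

End OrderedModule.

(** * Choice of the geometric weights *)

(** On the grid of step [d], let [k.+1] be the first positive index such that
    [b n] is [O((k.+1 * d) ^ n)], and take for [s1] and [s2] its two neighbours.
    By minimality [b] is not [O(s1 ^ n)], which gives [m]; the ratio of
    [k.+1 * d] to [s2] is below 1, which gives [M].  If [k] is 0 then [s1] is 0,
    and [m = 0] satisfies the first inequality trivially. *)
Lemma geometric_growth (R : realType) (b : nat -> R) (d : R) :
    0 < d -> 0 < b 0%N -> (forall n, 0 <= b n <= b 0%N) ->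
  exists s1 s2 m M, [/\ 0 <= s1 < s2, s2 <= s1 + 2 * d,
    0 < b m, s1 ^+ m.+1 * b 0%N <= d * b m
    & b (m + M).+1 <= d * (s2 ^+ M * b m)].
Proof.
move=> d0 b00 bb.
pose bounded s := exists C, forall n, b n <= C * s ^+ n.
have [k bk kmin] : exists2 k, bounded (k.+1%:R * d) &
    forall j, (j < k)%N -> ~ bounded (j.+1%:R * d).
  have ex_k : exists k, `[< bounded (k.+1%:R * d) >].
    have [N dN] : exists N : nat, 1 <= N.+1%:R * d.
      exists (Num.truncn d^-1); rewrite -ler_pdivrMr// mul1r.
      by apply: ltW; exact: truncnS_gt.
    exists N; apply/asboolP; exists (b 0%N) => n.
    have /andP[_ bn] := bb n; apply: (le_trans bn).
    by rewrite ler_peMr ?(ltW b00)// exprn_ege1.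
  have [k /asboolP bk kmin] := ex_minnP ex_k.
  exists k => // j ltjk bj; have := kmin j (asboolT bj).
  by rewrite leqNgt ltjk.
pose s := k.+1%:R * d; pose s1 := k%:R * d; pose s2 := k.+2%:R * d.
have s0 : 0 < s by rewrite mulr_gt0.
have s20 : 0 < s2 by rewrite mulr_gt0.
have s10 : 0 <= s1 by rewrite mulr_ge0 ?ler0n ?(ltW d0).
have [m bm s1m] : exists2 m, 0 < b m & s1 ^+ m.+1 * b 0%N <= d * b m.
  case: k @s @s1 @s2 bk kmin s0 s20 s10 => [|k] s s1 s2 bk kmin s0 s20 s10.
    by exists 0%N => //; rewrite /s1 mul0r expr0n mul0r mulr_ge0 ?ltW.
  have s1_gt0 : 0 < s1 by rewrite mulr_gt0.
  have /forallNP/(_ (s1 * b 0%N / d))/existsNP[m /negP] := kmin k (ltnSn k).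
  rewrite -ltNge -/s1 => lt_m; exists m.
    apply: le_lt_trans lt_m.
    by rewrite mulr_ge0 ?divr_ge0 ?mulr_ge0 ?exprn_ge0 ?ltW.
  have : d * (s1 * b 0%N / d * s1 ^+ m) <= d * b m.
    by rewrite ler_pM2l// ltW.
  apply: le_trans; rewrite exprS.
  by rewrite le_eqVlt; apply/orP; left; apply/eqP; field; rewrite gt_eqF.
have [C bC] := bk; rewrite -/s in bC.
have C0 : 0 < C by have := bC 0%N; rewrite expr0 mulr1; apply: lt_le_trans.
have [M hM] : exists M, (s / s2) ^+ M <= d * b m / (C * s ^+ m.+1).
  have q0 : 0 < d * b m / (C * s ^+ m.+1).
    by rewrite divr_gt0 ?mulr_gt0 ?exprn_gt0.
  have : `|s / s2| < 1.
    rewrite ger0_norm ?divr_ge0 ?ltW// ltr_pdivrMr// mul1r.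
    by rewrite ltr_pM2r// ltr_nat.
  move/cvg_expr => /cvgrPdist_le /(_ _ q0)[M _ /(_ M (leqnn M))] /=.
  rewrite sub0r normrN => /ler_normlW hM; by exists M.
exists s1, s2, m, M; split=> //.
- by rewrite s10 /s1 /s2 ltr_pM2r// ltr_nat ltnS leqnSn.
- by rewrite /s1 /s2 -[k.+2]addn2 natrD mulrDl.
apply: (le_trans (bC _)).
rewrite ler_pdivlMr ?mulr_gt0 ?exprn_gt0// in hM.
rewrite expr_div_n mulrAC ler_pdivrMr ?exprn_gt0// in hM.
have -> : C * s ^+ (m + M).+1 = s ^+ M * (C * s ^+ m.+1).
  by rewrite -addSn exprD; ring.
by rewrite (le_trans hM)// mulrAC mulrA.
Qed.

(** * Compactness for pointwise convergence *)

Section Pointwise.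
Context {R : realType} {V : choiceType}.
Let X := prod_topology (fun _ : V => (R : topologicalType)).

Lemma evaluation_continuous (u : V) : continuous (fun g : X => g u : R).
Proof. exact: (@proj_continuous V (fun _ => (R : topologicalType)) u). Qed.

Lemma closure_le (A : set X) (F G : X -> R) : continuous F -> continuous G ->
  (forall g, A g -> F g <= G g) -> forall g, closure A g -> F g <= G g.
Proof.
move=> cF cG AFG.
have cl : closed [set g | F g <= G g].
  have -> : [set g | F g <= G g] = (fun g => G g - F g) @^-1` [set x : R | 0 <= x].
    by apply/funext => g /=; rewrite subr_ge0.
  apply: preimage_closed; last exact: closed_ge.
  by move=> g _; apply: (@continuousB R R X); [exact: cG|exact: cF].
by move=> g /(closureS AFG); rewrite -(closure_id _).1.
Qed.

Lemma closure_eq (A : set X) (F G : X -> R) : continuous F -> continuous G ->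
  (forall g, A g -> F g = G g) -> forall g, closure A g -> F g = G g.
Proof.
move=> cF cG AFG g Ag; apply/eqP; rewrite eq_le.
by rewrite !(closure_le _ _ _ Ag)// => h /AFG ->.
Qed.

Lemma directed_compact (K : set X) (I : Type) (A : I -> set X) (i0 : I) :
    compact K ->
    (forall i, A i `<=` K) -> (forall i, A i !=set0) ->
    (forall i j, exists k, A k `<=` A i `&` A j) ->
  exists g, forall i, closure (A i) g.
Proof.
move=> cK AK A0 Adir.
have FF : ProperFilter (filter_from [set: I] A).
  apply: filter_from_proper => [|i _]; last exact: A0.
  by apply: filter_fromT_filter; [exists i0|].
have [|g [_ clg]] := cK _ FF; first by exists i0.
by exists g => i B; apply: clg; exists i.
Qed.

Lemma compact_box (c : V -> R) : compact [set g : X | forall u, `|g u| <= c u].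
Proof.
have -> : [set g : X | forall u, `|g u| <= c u] =
    [set g : X | forall u, [set` `[- c u, c u]] (g u)].
  apply/funext => g /=; apply/propext.
  by split=> h u; move: (h u); rewrite /= in_itv/= ler_norml.
apply: (@tychonoff V (fun _ => (R : topologicalType))
  (fun u => [set` `[- c u, c u]])) => u.
exact: segment_compact.
Qed.

End Pointwise.

(** * The order hull of a subspace *)

Section OrderHull.
Context {R : realType} {V : orderedLmodType R}.
Implicit Types (W : set V).

(** Elements of the hull are enclosed symmetrically by a vector of [W] because
    this is the form in which positive functionals are estimated. *)
Definition order_hull W : set V :=
  [set u | exists2 a, W a & 0 <= a - u /\ 0 <= a + u].

Lemma order_hull_subspace W : is_subspace W -> is_subspace (order_hull W).
Proof.
move=> sW; apply/subspace_closed; split.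
  by exists 0; [exact: subspace0|rewrite subr0 addr0].
move=> r x y [a Wa [ax ax']] [b Wb [b_y b_y']].
exists (`|r| *: a + b); first exact: subspaceZD.
have rx : 0 <= `|r| *: a - r *: x /\ 0 <= `|r| *: a + r *: x.
  have [r0|/ltW r0] := leP 0 r.
    by rewrite ger0_norm// -scalerBr -scalerDr; split; exact: olmod_scaler_ge0.
  have -> : r *: x = - ((- r) *: x) by rewrite scaleNr opprK.
  rewrite ler0_norm// opprK -scalerDr -scalerBr; rewrite -oppr_ge0 in r0.
  by split; exact: olmod_scaler_ge0.
by rewrite opprD !(addrACA _ b); case: rx; split; exact: olmod_addr_ge0.
Qed.

Lemma order_hull_convex W : is_subspace W -> order_convex (order_hull W).
Proof.
move=> sW x y z [a Wa [ax ax']] [b Wb [bz bz']] /andP[xy yz].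
rewrite -(olmod_subr_ge0 x) in xy; rewrite -(olmod_subr_ge0 y) in yz.
have ge0_half (c u : V) : 0 <= c - u -> 0 <= c + u -> 0 <= c.
  move=> cu cu'; have := olmod_addr_ge0 cu cu'; rewrite addrACA addNr addr0.
  move/(olmod_scaler_ge0 (a := 2^-1 : R)); rewrite invr_ge0 ler0n => /(_ isT).
  by rewrite -mulr2n -[c *+ 2]scaler_nat scalerA mulVf ?scale1r// pnatr_eq0.
exists (a + b); first exact: subspaceD.
split.
  rewrite -addrA; apply: olmod_addr_ge0; first exact: ge0_half ax'.
  by rewrite -[b](subrK z) -addrA; exact: olmod_addr_ge0.
rewrite addrAC; apply: olmod_addr_ge0; last exact: ge0_half bz'.
by rewrite -[y](subrK x) (addrC _ x) addrA; exact: olmod_addr_ge0.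
Qed.

End OrderHull.

(** * The action on the order hull of the orbit span *)

Section Orbit.
Context {R : realType} {V : orderedLmodType R}.
Context (S : set {linear V -> V}) (v : V).
Context (S_monoid : map_monoid S) (S_comm : commuting_maps S).
Context (S_pos : forall T : {linear V -> V}, S T -> positive_map T).
Context (v_pos : 0 <= v).
Implicit Types (T U : {linear V -> V}) (u : V) (f g h : V -> R).

Let W := linear_span (map_orbit S v).
Let E := order_hull W.

Let sW : is_subspace W := linear_span_subspace (map_orbit S v).
Let sE : is_subspace E := order_hull_subspace sW.

Lemma orbit_sub_span T : S T -> W (T v).
Proof. by move=> ST A [_]; apply; exists T. Qed.

Lemma orbit_sub_hull T : S T -> E (T v).
Proof.
move=> ST; exists (T v); first exact: orbit_sub_span.
by rewrite subrr; split=> //; apply: olmod_addr_ge0; exact: S_pos.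
Qed.

Lemma span_sub_hull : W `<=` E.
Proof. by apply: smallest_sub => // _ [T ST <-]; exact: orbit_sub_hull. Qed.

Lemma orbit_ideal_sub_hull : orbit_ideal S v `<=` E.
Proof.
apply: smallest_sub; first by split=> //; exact: order_hull_convex.
by move=> _ [T ST <-]; exact: orbit_sub_hull.
Qed.

Lemma hull_v : E v.
Proof. by have := orbit_sub_hull S_monoid.1. Qed.

Lemma span_stable T u : S T -> W u -> W (T u).
Proof.
move=> ST; suff: W `<=` [set u | W (T u)] by apply.
apply: smallest_sub.
  apply/subspace_closed; split=> /= [|a x y Wx Wy].
    by rewrite linear0; exact: (subspace0 sW).
  by rewrite linearP; exact: (subspaceZD _ sW).
by move=> _ [U SU <-]; exact: (orbit_sub_span (S_monoid.2 _ _ ST SU)).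
Qed.

Lemma hull_stable T u : S T -> E u -> E (T u).
Proof.
move=> ST [a Wa [au au']]; exists (T a); first exact: span_stable.
by rewrite -linearB -linearD; split; exact: S_pos.
Qed.

Definition positive_orbit_bounded : set (V -> R) :=
  [set h | positive_functional_on E h /\
           exists M, forall U, S U -> h (U v) <= M].

Lemma positive_functional_comp T h : S T ->
  positive_functional_on E h -> positive_functional_on E (h \o T).
Proof.
move=> ST [lh ph]; split=> [a x y Ex Ey|x Ex x0] /=.
  by rewrite linearP lh//; exact: hull_stable.
by apply: ph; [exact: hull_stable|exact: S_pos].
Qed.

(** The bound for [u] comes from one for a vector [a] of the span of the orbit with
    [- a <= u <= a], and a vector of that span is a fixed finite combination of
    elements of the orbit. *)
Lemma orbit_gauge u : E u -> exists c, forall h M,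
  positive_functional_on E h -> (forall U, S U -> h (U v) <= M) ->
  `|h u| <= c * M.
Proof.
have gaugeW : W `<=` [set a | E a /\ exists c, forall h M,
    positive_functional_on E h -> (forall U, S U -> h (U v) <= M) ->
    `|h a| <= c * M].
  apply: smallest_sub.
    apply/subspace_closed; split=> /= [|r x y [Ex [c hc]] [Ey [c' hc']]].
      split; first exact: subspace0.
      by exists 0 => h M [lh _] _; rewrite (functional0 sE lh) normr0 mul0r.
    split; first exact: subspaceZD.
    exists (`|r| * c + c') => h M ph hM.
    rewrite ph.1// (le_trans (ler_normD _ _))// mulrDl lerD ?hc'//.
    by rewrite normrM -mulrA ler_wpM2l ?hc.
  move=> _ [T ST <-]; split; first exact: orbit_sub_hull.
  exists 1 => h M ph hM; rewrite mul1r ger0_norm ?hM//.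
  by apply: ph.2; [exact: orbit_sub_hull|exact: S_pos].
move=> Eu; have [a Wa [au au']] := Eu.
have [Ea [c hc]] := gaugeW a Wa.
exists c => h M ph hM; apply: le_trans (hc h M ph hM).
have [lh h_pos] := ph.
rewrite (le_trans _ (ler_norm _))// ler_norml.
have := h_pos _ (subspaceD sE Ea Eu) au'.
have := h_pos _ (subspaceD sE Ea (subspaceN sE Eu)) au.
by rewrite (functionalB lh)// (functionalD lh)// => ? ?; lra.
Qed.

(** * Approximate eigenfunctionals of a single map *)

(** The sum of [s ^+ (j - 1 - i) * g i] over [i < j], in Horner form. *)
Fixpoint geometric_sum (s : R) (g : nat -> V -> R) (j : nat) (u : V) : R :=
  if j is k.+1 then s * geometric_sum s g k u + g k u else 0.

Lemma geometric_sum_shift (s : R) (g : nat -> V -> R) (F : V -> V) j u :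
    (forall n w, g n (F w) = g n.+1 w) ->
  geometric_sum s g j (F u) =
    s * geometric_sum s g j u + g j u - s ^+ j * g 0%N u.
Proof.
move=> gF; elim: j => [|j IH] /=; first by rewrite expr0; ring.
by rewrite IH gF exprS; ring.
Qed.

Lemma geometric_sum_recl (s : R) (g : nat -> V -> R) j u :
  geometric_sum s g j.+1 u =
    s ^+ j * g 0%N u + geometric_sum s (fun n => g n.+1) j u.
Proof.
elim: j => [|j IH] /=; first by rewrite expr0; ring.
by rewrite -[s * _ + g j u]/(geometric_sum s g j.+1 u) IH exprS; ring.
Qed.

(** The closure properties that the construction of
    [approximate_eigenfunctional] relies on.  Keeping the cone abstract makes the
    construction preserve the eigenvalues already fixed for other maps. *)
Record invariant_cone (K : set (V -> R)) := InvariantCone {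
  cone_sub : K `<=` positive_orbit_bounded;
  coneD : forall f g, K f -> K g -> K (fun u => f u + g u);
  coneZ : forall (a : R) f, 0 <= a -> K f -> K (fun u => a * f u);
  cone_comp : forall T f, S T -> K f -> K (fun u => f (T u)) }.

Definition orbit_sup (h : V -> R) := sup [set h (U v) | U in S].

Lemma orbit_sup_ub h U : positive_orbit_bounded h -> S U ->
  h (U v) <= orbit_sup h.
Proof.
move=> [_ [M hM]] SU; apply: ub_le_sup; last by exists U.
by exists M => _ [T ST <-]; exact: hM.
Qed.

Lemma orbit_sup_le h (M : R) : (forall U, S U -> h (U v) <= M) ->
  orbit_sup h <= M.
Proof.
move=> hM; apply: ge_sup; first by exists (h v), idfun => //; exact: S_monoid.1.
by move=> _ [T ST <-]; exact: hM.
Qed.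

Lemma orbit_sup_adherent h (c : R) :
  c < orbit_sup h -> exists2 U, S U & c < h (U v).
Proof.
move=> /sup_gt[]; first by exists (h v), idfun => //; exact: S_monoid.1.
by move=> _ [U SU <-]; exists U.
Qed.

Lemma cone_geometric_sum K (s : R) (g : nat -> V -> R) j : invariant_cone K ->
  0 <= s -> (forall n, K (g n)) -> K (geometric_sum s g j).
Proof.
move=> cK s0 Kg; elim: j => [|j IH].
  have -> : geometric_sum s g 0 = (fun u => 0 * g 0%N u).
    by apply/funext => u; rewrite mul0r.
  exact: (coneZ cK).
by apply: (coneD cK) => //; exact: (coneZ cK).
Qed.

(** [c] is a gauge as provided by [orbit_gauge].  The error is measured by [c]
    because that is the form in which it can be passed to a pointwise limit. *)
Lemma approximate_eigenfunctional K f T (c : V -> R) (d : R) :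
    invariant_cone K -> K f -> 0 < f v -> S T -> 0 < d ->
    (forall u, E u -> forall h M, positive_functional_on E h ->
      (forall U, S U -> h (U v) <= M) -> `|h u| <= c u * M) ->
  exists h s, [/\ K h, forall U, S U -> h (U v) <= 1, 2^-1 <= h v
    & forall u, E u -> `|h (T u) - s * h u| <= 4 * d * c u].
Proof.
move=> cK Kf fv0 ST d0 hc.
have ge0 h U : K h -> S U -> 0 <= h (U v).
  move=> /(cone_sub cK)[[_ ph] _] SU.
  by apply: ph; [exact: orbit_sub_hull|exact: S_pos].
have ub h U : K h -> S U -> h (U v) <= orbit_sup h.
  by move=> /(cone_sub cK) hb; exact: orbit_sup_ub.
pose g n u := f (iter n T u).
have gT n u : g n (T u) = g n.+1 u by rewrite /g iterSr.
have Kg n : K (g n).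
  elim: n => [//|n IH]; rewrite (_ : g n.+1 = fun u => g n (T u)).
    exact: (cone_comp cK).
  by apply/funext => u; rewrite gT.
pose b n := orbit_sup (g n).
have gb n U : S U -> g n (U v) <= b n by move=> SU; exact: ub.
have b0 n : 0 <= b n.
  by apply: (le_trans (ge0 (g n) _ (Kg n) S_monoid.1)); exact: gb S_monoid.1.
have b_dec n : b n.+1 <= b n.
  apply: orbit_sup_le => U SU; rewrite -gT.
  exact: (gb n _ (S_monoid.2 _ _ ST SU)).
have b00 : 0 < b 0%N by apply: lt_le_trans fv0 _; exact: (gb 0%N _ S_monoid.1).
have [|s1 [s2 [m [M [/andP[s10 s12] s21 bm0 low high]]]]] :=
    geometric_growth d0 b00 (b := b).
  move=> n; rewrite b0/=; elim: n => [//|n IH].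
  exact: le_trans (b_dec n) IH.
have s20 : 0 < s2 by exact: le_lt_trans s12.
have s2M : 0 < s2 ^+ M by exact: exprn_gt0.
(* [G] is the sum of the [g n] with weights [s1 ^- n] for [n < m] and then
   [s1 ^- m * s2 ^- (n - m)], all multiplied by [s1 ^+ m * s2 ^+ M] because [s1]
   may vanish. *)
pose A u := s2 ^+ M * (s1 * geometric_sum s1 g m u).
pose B := geometric_sum s2 (fun n => g (m + n)%N) M.+1.
pose B' := geometric_sum s2 (fun n => g (m + n.+1)%N) M.
pose G u := A u + B u.
have KA : K A.
  by do 2?[apply: (coneZ cK) => //; rewrite ?ltW//]; exact: cone_geometric_sum.
have KB : K B by apply: cone_geometric_sum => //; exact: ltW.
have KB' : K B' by apply: cone_geometric_sum => //; exact: ltW.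
have KG : K G by exact: (coneD cK).
have BE u : B u = s2 ^+ M * g m u + B' u.
  by rewrite /B geometric_sum_recl addn0.
(* Telescoping leaves three positive functionals, up to signs: the change of
   ratio from [s1] to [s2] along [B'], which is dominated by [(s2 - s1) * G], and
   the two ends of the sum. *)
have GT u : G (T u) - s1 * G u =
    (s2 - s1) * B' u - s2 ^+ M * s1 ^+ m.+1 * f u + g (m + M).+1 u.
  have gmT n w : g (m + n)%N (T w) = g (m + n.+1)%N w by rewrite gT addnS.
  rewrite /G mulrDr /A (geometric_sum_shift _ _ _ gT).
  rewrite [B (T u)](geometric_sum_shift _ _ _ gmT) -/(B u) BE.
  by rewrite addn0 addnS /g /= !exprS; ring.
have B'G U : S U -> B' (U v) <= orbit_sup G.
  move=> SU; apply: le_trans (ub _ _ KG SU); rewrite /G BE.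
  have := ge0 _ _ KA SU; have := mulr_ge0 (ltW s2M) (ge0 _ _ (Kg m) SU); lra.
have bmG : s2 ^+ M * b m <= orbit_sup G.
  rewrite mulrC -ler_pdivlMr//; apply: orbit_sup_le => U SU.
  rewrite ler_pdivlMr// mulrC; apply: le_trans (ub _ _ KG SU); rewrite /G BE.
  have := ge0 _ _ KA SU; have := ge0 _ _ KB' SU; lra.
set p := orbit_sup G in B'G bmG *.
have p0 : 0 < p by apply: lt_le_trans bmG; rewrite mulr_gt0.
(* [G v] itself may be much smaller than [p]; composing with a [W'] that almost
   attains the supremum repairs this. *)
have [|W' SW ltW'] := @orbit_sup_adherent G (2^-1 * p).
  by rewrite -/p; lra.
have SWU U : S U -> S (W' \o U) by exact: S_monoid.2.
exists (fun u => p^-1 * G (W' u)), s1; split=> [|U SU||u Eu].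
- apply: (coneZ cK); first by rewrite invr_ge0 ltW.
  by apply: (cone_comp cK (f := G)).
- by rewrite mulrC ler_pdivrMr// mul1r; apply: (ub G (W' \o U)) => //; exact: SWU.
- by rewrite mulrC ler_pdivlMr// ltW.
have -> : W' (T u) = T (W' u) by exact: S_comm.
rewrite mulrCA -mulrBr GT normrM gtr0_norm ?invr_gt0// mulrC ler_pdivrMr//.
have gaugeW h (N : R) : K h -> (forall U, S U -> h (U v) <= N) ->
    `|h (W' u)| <= c u * N.
  move=> Kh hN; apply: (hc u Eu (h \o W')).
    by apply: positive_functional_comp => //; case: (cone_sub cK Kh).
  by move=> U SU; exact: (hN _ (SWU _ SU)).
have e1 : `|(s2 - s1) * B' (W' u)| <= c u * (2 * d * p).
  apply: (gaugeW (fun w => (s2 - s1) * B' w)) => [|U SU].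
    by apply: (coneZ cK) => //; lra.
  by apply: ler_pM; [lra|exact: ge0|lra|exact: B'G].
have e2 : `|s2 ^+ M * s1 ^+ m.+1 * f (W' u)| <= c u * (d * p).
  apply: (gaugeW (fun w => s2 ^+ M * s1 ^+ m.+1 * f w)) => [|U SU].
    by apply: (coneZ cK) => //; rewrite mulr_ge0 ?exprn_ge0// ltW.
  apply: (@le_trans _ _ (s2 ^+ M * (s1 ^+ m.+1 * b 0%N))).
    rewrite -mulrA ler_wpM2l ?(ltW s2M)// ler_wpM2l ?exprn_ge0//.
    exact: (gb 0%N).
  apply: le_trans (_ : d * (s2 ^+ M * b m) <= _).
    by rewrite [leRHS]mulrCA ler_wpM2l// ltW.
  by rewrite ler_wpM2l// ltW.
have e3 : `|g (m + M).+1 (W' u)| <= c u * (d * p).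
  apply: gaugeW => // U SU; apply: (le_trans (gb _ _ SU)).
  by apply: (le_trans high); rewrite ler_wpM2l// ltW.
have -> : 4 * d * c u * p = c u * (2 * d * p) + c u * (d * p) + c u * (d * p).
  by ring.
rewrite (le_trans (ler_normD _ _))// lerD// (le_trans (ler_normB _ _))//.
exact: lerD.
Qed.

(** * From approximate to common exact eigenfunctionals *)

(** When [g v] is non-zero this says that [g] is an eigenvector of the adjoint of
    [T], with eigenvalue [g (T v) / g v].  Not naming the eigenvalue keeps the
    condition closed under pointwise limits along which eigenvalues vary. *)
Definition eigenrelation T (g : V -> R) :=
  forall u, E u -> g (T u) * g v = g (T v) * g u.

(** The bound [2^-1 <= g v], unlike a condition on the supremum over the orbit,
    survives pointwise limits; it keeps them away from zero.  The bound by [c]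
    on all of [V] puts these functions in a compact box. *)
Definition eigenstates (c : V -> R) (L : set {linear V -> V}) : set (V -> R) :=
  [set g | [/\ positive_functional_on E g, forall U, S U -> g (U v) <= 1,
    2^-1 <= g v, forall u, `|g u| <= c u & forall T, L T -> eigenrelation T g]].

Lemma eigenstates_antitone c L L' : L `<=` L' -> eigenstates c L' `<=` eigenstates c L.
Proof. by move=> LL' g [pg g1 gv gc gL]; split=> // T /LL'; exact: gL. Qed.

Let X := prod_topology (fun _ : V => (R : topologicalType)).

Lemma eigenstates_closed c L :
  @closure X (eigenstates c L) `<=` eigenstates c L.
Proof.
move=> g clg.
have le (F G : X -> R) : continuous F -> continuous G ->
    (forall h, eigenstates c L h -> F h <= G h) -> F g <= G g.
  by move=> cF cG FG; exact: (closure_le cF cG FG clg).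
have eq (F G : X -> R) : continuous F -> continuous G ->
    (forall h, eigenstates c L h -> F h = G h) -> F g = G g.
  by move=> cF cG FG; exact: (closure_eq cF cG FG clg).
have ev u : continuous (fun g : X => g u : R) by exact: evaluation_continuous.
have cs (a : R) : continuous (fun _ : X => a) by exact: cst_continuous.
have cD (F G : X -> R) : continuous F -> continuous G ->
    continuous (fun g : X => F g + G g).
  by move=> cF cG h; apply: (@continuousD R R X); [exact: cF|exact: cG].
have cM (F G : X -> R) : continuous F -> continuous G ->
    continuous (fun g : X => F g * G g).
  by move=> cF cG h; apply: (@continuousM R X); [exact: cF|exact: cG].
split.
- split=> [a x y Ex Ey|x Ex x0].
    apply: (eq (fun g => g (a *: x + y)) (fun g => a * g x + g y)) => //.
      by apply: cD => //; exact: cM.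
    by move=> h [[lh _] _ _ _ _]; exact: lh.
  apply: (le (fun _ => 0) (fun g => g x)) => //.
  by move=> h [[_ ph] _ _ _ _]; exact: ph.
- move=> U SU; apply: (le (fun g => g (U v)) (fun _ => 1)) => //.
  by move=> h [_ h1 _ _ _]; exact: h1.
- by apply: (le (fun _ => 2^-1) (fun g => g v)) => // h [].
- move=> u; rewrite ler_norml; apply/andP; split.
    apply: (le (fun _ => - c u) (fun g => g u)) => // h [_ _ _ /(_ u)].
    by rewrite ler_norml => /andP[].
  apply: (le (fun g => g u) (fun _ => c u)) => // h [_ _ _ /(_ u)].
  by rewrite ler_norml => /andP[].
- move=> T LT u Eu.
  apply: (eq (fun g => g (T u) * g v) (fun g => g (T v) * g u)).
  + exact: cM.
  + exact: cM.
  + by move=> h [_ _ _ _ /(_ T LT)]; apply.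
Qed.

(** Off [E] the gauge only has to leave room in the compact box for functions
    that vanish there. *)
Definition gauge_on_hull (c : V -> R) :=
  (forall u, E u -> forall h M, positive_functional_on E h ->
      (forall U, S U -> h (U v) <= M) -> `|h u| <= c u * M) /\
  (forall u, ~ E u -> 0 <= c u).

Lemma gauge_on_hull_exists : exists c, gauge_on_hull c.
Proof.
have [u|c hc] := @choice _ _ (fun u a => (E u -> forall h M,
    positive_functional_on E h -> (forall U, S U -> h (U v) <= M) ->
    `|h u| <= a * M) /\ (~ E u -> 0 <= a)).
  have [Eu|nEu] := pselect (E u); last by exists 0; split.
  by have [a ha] := orbit_gauge Eu; exists a; split.
by exists c; split=> u; have [] := hc u.
Qed.

(** By commutativity of [S], composing with a member of [S] does not disturb the
    eigenvalue for another one. *)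
Lemma invariant_eigencone L (t : {linear V -> V} -> R) : L `<=` S ->
  invariant_cone [set h | positive_orbit_bounded h /\
    forall U, L U -> forall u, E u -> h (U u) = t U * h u].
Proof.
move=> LS; split.
- by move=> h [].
- move=> f g [[[lf pf] [M hM]] fL] [[[lg pg] [N gN]] gL]; split; last first.
    by move=> U LU u Eu; rewrite fL// gL// mulrDr.
  split; last by exists (M + N) => U SU; apply: lerD; [exact: hM|exact: gN].
  split=> [a x y Ex Ey|x Ex x0]; last by rewrite addr_ge0 ?pf ?pg.
  by rewrite lf// lg//; ring.
- move=> a f a0 [[[lf pf] [M hM]] fL]; split; last first.
    by move=> U LU u Eu; rewrite fL//; ring.
  split; last by exists (a * M) => U SU; apply: ler_wpM2l => //; exact: hM.
  split=> [b x y Ex Ey|x Ex x0]; last by rewrite mulr_ge0 ?pf.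
  by rewrite lf//; ring.
- move=> T f ST [[pf [M hM]] fL]; split; last first.
    move=> U LU u Eu; have -> : T (U u) = U (T u) by exact: (S_comm ST (LS _ LU)).
    by rewrite fL//; exact: hull_stable.
  split; first exact: (positive_functional_comp ST pf).
  by exists M => U SU; exact: (hM _ (S_monoid.2 _ _ ST SU)).
Qed.

(** Only the values on [E] matter, and the gauge does not control the others:
    they are replaced by 0 to fit in the compact box. *)
Lemma eigenstate_restriction c L (t : {linear V -> V} -> R) h :
    L `<=` S -> gauge_on_hull c -> positive_functional_on E h ->
    (forall U, S U -> h (U v) <= 1) -> 2^-1 <= h v ->
    (forall U, L U -> forall u, E u -> h (U u) = t U * h u) ->
  exists2 g, eigenstates c L g & forall u, E u -> g u = h u.
Proof.
move=> LS [hc c0] [lh ph] h1 hv hL.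
pose g u := if pselect (E u) then h u else 0.
have gE u : E u -> g u = h u by rewrite /g; case: pselect.
exists g => //; split=> [|U SU||u|T LT u Eu].
- split=> [a x y Ex Ey|x Ex x0]; last by rewrite gE ?ph.
  by rewrite !gE//; [exact: lh|exact: subspaceZD].
- by rewrite gE ?h1//; exact: orbit_sub_hull.
- by rewrite gE//; exact: hull_v.
- rewrite /g; case: pselect => [Eu|nEu]; last by rewrite normr0 c0.
  by rewrite -[c u]mulr1; exact: hc.
- have Ev := hull_v; have ST := LS _ LT.
  rewrite !gE//; try exact: hull_stable.
  by rewrite !hL//; ring.
Qed.

Lemma eq0_of_le_inv (x C : R) : (forall n : nat, `|x| <= n.+1%:R^-1 * C) -> x = 0.
Proof.
move=> hx; apply/eqP; rewrite -normr_eq0 eq_le normr_ge0 andbT leNgt.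
apply/negP => x0; have := truncnS_gt (C / `|x|).
rewrite ltr_pdivrMr// => hC; have := hx (Num.truncn (C / `|x|)).
by rewrite mulrC ler_pdivlMr// mulrC leNgt hC.
Qed.

(** Among the eigenstates for [L], those satisfying the eigenrelation for [T] up
    to a multiple of [n.+1%:R^-1] form a decreasing sequence of non-empty sets in
    a compact box; a common closure point satisfies it exactly. *)
Lemma eigenstates_add_generator c L T : gauge_on_hull c -> L `<=` S -> S T ->
  eigenstates c L !=set0 -> eigenstates c (L `|` [set T]) !=set0.
Proof.
move=> gc LS ST [f [pf f1 fv fc fL]].
have fv0 : 0 < f v by apply: lt_le_trans fv; rewrite invr_gt0.
pose t U := f (U v) / f v.
have c0 u : 0 <= c u by apply: le_trans (fc u).
pose C u := 4 * (c u + c v * c u).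
have C0 u : 0 <= C u by rewrite mulr_ge0 ?addr_ge0 ?mulr_ge0.
pose A n : set X := [set g | eigenstates c L g /\
  forall u, E u -> `|g (T u) * g v - g (T v) * g u| <= n.+1%:R^-1 * C u].
have A0 n : A n !=set0.
  have d0 : 0 < n.+1%:R^-1 :> R by rewrite invr_gt0.
  have Kf : positive_orbit_bounded f /\
      forall U, L U -> forall u, E u -> f (U u) = t U * f u.
    split; first by split=> //; exists 1.
    move=> U LU u Eu; by rewrite /t mulrAC -fL// mulfK ?gt_eqF.
  have [h [s [[[ph _] hL] h1 hv hT]]] :=
    approximate_eigenfunctional (invariant_eigencone t LS) Kf fv0 ST d0 gc.1.
  have [g gs gE] := eigenstate_restriction LS gc ph h1 hv hL.
  exists g; split=> // u Eu; have Ev := hull_v.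
  have [_ g1 gv gcu _] := gs.
  have ETu := hull_stable ST Eu; have ETv := hull_stable ST Ev.
  (* Eliminating the approximate eigenvalue [s] from the estimates at [u] and [v]
     gives the quadratic form of the eigenrelation. *)
  have -> : g (T u) * g v - g (T v) * g u =
      (h (T u) - s * h u) * g v + (s * h v - h (T v)) * g u.
    by rewrite !gE//; ring.
  have -> : n.+1%:R^-1 * C u = 4 * n.+1%:R^-1 * c u * 1 +
      4 * n.+1%:R^-1 * c v * c u by rewrite /C; ring.
  rewrite (le_trans (ler_normD _ _))// !normrM lerD// ler_pM//.
  - exact: hT.
  - rewrite ger0_norm; first exact: (g1 idfun S_monoid.1).
    by apply: le_trans gv; rewrite invr_ge0.
  - by rewrite distrC; exact: hT.
have [g clg] : exists g : X, forall n, @closure X (A n) g.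
  apply: (directed_compact (K := [set g : X | forall u, `|g u| <= c u]) 0%N) => //.
  - exact: compact_box.
  - by move=> n g [[]].
  - move=> i j; exists (maxn i j) => g [gs gT]; split; split=> // u Eu;
      apply: le_trans (gT u Eu) _; rewrite ler_wpM2r// lef_pV2 ?posrE//
      ler_nat ltnS ?leq_maxl ?leq_maxr //.
have gs : eigenstates c L g.
  by apply: eigenstates_closed; apply: (closureS _ (clg 0%N)) => h [].
exists g; case: gs => pg g1 gv gcu gL; split=> // U [LU|->]; first exact: gL.
move=> u Eu; apply/eqP; rewrite -subr_eq0; apply/eqP.
apply: (@eq0_of_le_inv _ (C u)) => n.
have ev w : continuous (fun g : X => g w : R) by exact: evaluation_continuous.
apply: (closure_le (F := fun g : X => `|g (T u) * g v - g (T v) * g u|)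
  (G := fun=> n.+1%:R^-1 * C u) _ _ _ (clg n)).
- move=> h; apply: (@continuous_comp X R R
    (fun g : X => g (T u) * g v - g (T v) * g u) (fun x : R => `|x|)).
    by apply: (@continuousB R R X); apply: (@continuousM R X); exact: ev.
  exact: norm_continuous.
- exact: cst_continuous.
- by move=> h [_ /(_ u Eu)].
Qed.

(** The extension [f] of [phi] need not satisfy [2^-1 <= f v] relative to its
    supremum over the orbit; [approximate_eigenfunctional] for the identity map
    trades it for a functional that does. *)
Lemma normalized_functional_exists c : gauge_on_hull c ->
    (exists phi : V -> R, [/\ positive_functional_on W phi,
       bounded_on (map_orbit S v) phi & phi v <> 0]) ->
  eigenstates c set0 !=set0.
Proof.
move=> gc [phi [pphi [M hM] phiv]].
have [|f pf fphi] := positive_functional_extension sW sE span_sub_hull _ pphi.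
  move=> u [a Wa [au _]]; exists a => //.
  by rewrite -olmod_subr_ge0.
have fv0 : 0 < f v.
  rewrite lt_neqAle eq_sym pf.2 ?andbT//; last exact: hull_v.
  by rewrite fphi; [exact/eqP|exact: (orbit_sub_span S_monoid.1)].
have sub0 : set0 `<=` S by [].
have Kf : positive_orbit_bounded f /\ forall U, set0 U ->
    forall u, E u -> f (U u) = 0 * f u.
  split=> //; split=> //; exists M => U SU.
  rewrite fphi; last exact: orbit_sub_span.
  by apply: le_trans (ler_norm _) _; apply: hM; exists U.
have [h [s [[[ph _] hL] h1 hv _]]] := approximate_eigenfunctional
  (invariant_eigencone (fun=> 0) sub0) Kf fv0 S_monoid.1 ltr01 gc.1.
by have [g gs _] := eigenstate_restriction sub0 gc ph h1 hv hL; exists g.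
Qed.

Lemma common_eigenstate c : gauge_on_hull c -> eigenstates c set0 !=set0 ->
  eigenstates c S !=set0.
Proof.
move=> gc s0.
pose gen (l : seq {linear V -> V}) := [set T | S T /\ List.In T l].
have gen0 l : eigenstates c (gen l) !=set0.
  elim: l => [|T l [g gs]].
    by have [g gs] := s0; exists g; apply: eigenstates_antitone gs => T [].
  have genS : gen l `<=` S by move=> U [].
  have [ST|nST] := pselect (S T).
    have [|h hs] := eigenstates_add_generator gc genS ST; first by exists g.
    exists h; apply: eigenstates_antitone hs => U [SU [<-|lU]]; first by right.
    by left.
  exists g; apply: eigenstates_antitone gs => U [SU [TU|lU]] //.
  by case: nST; rewrite TU.
have [g clg] : exists g : X, forall l, @closure X (eigenstates c (gen l)) g.
  apply: (directed_compact (K := [set g : X | forall u, `|g u| <= c u]) [::]) => //.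
  - exact: compact_box.
  - by move=> l g [].
  - move=> l l'; exists (l ++ l') => g gs; split; apply: eigenstates_antitone gs;
      move=> U [SU lU]; split=> //; apply: List.in_or_app; by [left|right].
exists g; have [pg g1 gv gc' _] := eigenstates_closed (clg [::]).
split=> // T ST; have [_ _ _ _] := eigenstates_closed (clg [:: T]).
by apply; split=> //; left.
Qed.

(** If [t T > 1], then applying [T] would multiply the finite positive supremum of
    [g] over the orbit by a factor larger than 1 without leaving the orbit. *)
Lemma eigenstate_character c g : eigenstates c S g ->
  exists t : {linear V -> V} -> R, unit_interval_morphism S t /\
    forall T u, S T -> E u -> g (T u) = t T * g u.
Proof.
move=> [pg g1 gv _ gS].
have gv0 : 0 < g v by apply: lt_le_trans gv; rewrite invr_gt0.
pose t T := g (T v) / g v.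
have gt T u : S T -> E u -> g (T u) = t T * g u.
  move=> ST Eu; by rewrite /t mulrAC -gS// mulfK ?gt_eqF.
have gb : positive_orbit_bounded g by split=> //; exists 1.
exists t; split=> //; split=> [T ST||T U ST SU].
- have t0 : 0 <= t T.
    by rewrite divr_ge0 ?(ltW gv0)// pg.2//; [exact: orbit_sub_hull|exact: S_pos].
  rewrite t0 leNgt; apply/negP => t1.
  have p0 : 0 < orbit_sup g.
    by apply: lt_le_trans gv0 _; exact: (orbit_sup_ub gb S_monoid.1).
  have tT0 : 0 < t T by exact: lt_trans t1.
  have : orbit_sup g <= orbit_sup g / t T.
    apply: orbit_sup_le => U SU; rewrite ler_pdivlMr// mulrC -gt//.
      exact: (orbit_sup_ub gb (S_monoid.2 _ _ ST SU)).
    exact: orbit_sub_hull.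
  by rewrite ler_pdivlMr// ger_pMr// leNgt t1.
- by rewrite /t divff ?gt_eqF.
- by rewrite {1}/t /= gt//; [rewrite mulrA|exact: orbit_sub_hull].
Qed.

End Orbit.

Theorem theorem3 (R : realType) (V : orderedLmodType R)
    (S : set {linear V -> V}) (v : V)
    (S_monoid : map_monoid S) (S_comm : commuting_maps S)
    (S_pos : forall T : {linear V -> V}, S T -> positive_map T)
    (v_pos : 0 <= v)
    (phi_ex : exists phi : V -> R,
       [/\ positive_functional_on (linear_span (map_orbit S v)) phi,
           bounded_on (map_orbit S v) phi
         & phi v <> 0]) :
  exists (J : V -> R) (t : {linear V -> V} -> R),
    [/\ positive_functional_on (orbit_ideal S v) J,
        unit_interval_morphism S t,
        (forall (T : {linear V -> V}) (u : V),
           S T -> orbit_ideal S v u -> J (T u) = t T * J u)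
      & J v = 1].
Proof.
have [c gc] := gauge_on_hull_exists S_pos v_pos.
have s0 := normalized_functional_exists S_monoid S_comm S_pos v_pos gc phi_ex.
have [g gs] := common_eigenstate S_monoid S_comm S_pos v_pos gc s0.
have [t [t_morph gt]] := eigenstate_character S_monoid S_pos v_pos gs.
have ideal_sub := orbit_ideal_sub_hull S_pos v_pos.
have [[lg pg] _ gv _ _] := gs.
have gv0 : 0 < g v by apply: lt_le_trans gv; rewrite invr_gt0.
exists (fun u => g u / g v), t; split=> // [|T u ST /ideal_sub Eu|].
- split=> [a x y /ideal_sub Ex /ideal_sub Ey|x /ideal_sub Ex x0].
    by rewrite lg// mulrDl mulrA.
  by rewrite divr_ge0 ?(ltW gv0)// pg.
- by rewrite gt// mulrA.
- by rewrite divff// gt_eqF.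
Qed.
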